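(* Let $\tau\in\mathbb C[V]^G$ be homogeneous of degree $d$, fix invariant coordinates, and let $A_1,\dots,A_d$ be multi-indices with $A_1,\dots,A_{d'}\ne\emptyset$, $A_{d'+1}=\dots=A_d=\emptyset$, and $M=2(|A_1|+\dots+|A_d|)-d'$. For a formal morphism $f:\mathbb C[Z]\to\mathbb C[[X_1,\dots,X_p]]$ with $f(\tilde\Delta)\neq0$ define $$\tilde{\mathfrak T}(A_1,\dots,A_d)(f)=\sum_{1\le|I_1|\le|A_1|,\dots,1\le|I_{d'}|\le|A_{d'}|}\ \prod_{k=1}^{d'}a_{A_k,I_k}\big((\partial_B f(z_i))_{i,B}\big)\cdot f\big(\tilde T(I_1,\dots,I_{d'},\emptyset,\dots,\emptyset)\big)\in\mathbb C((X_1,\dots,X_p)).$$ Then: (1) for every formal morphism $F:\mathbb C[V]\to\mathbb C[[X_1,\dots,X_p]]$ such that $f:=F|_{\mathbb C[V]^G}$ satisfies $f(\tilde\Delta)\ne0$, we have $\tilde{\mathfrak T}(A_1,\dots,A_d)(f)=\mathfrak T(A_1,\dots,A_d)(F)$; (2) for every formal morphism $f$ from $\mathbb C^p$ to $Z$ with $f(\tilde\Delta)\ne0$, $f(\tilde\Delta_M)\cdot\tilde{\mathfrak T}(A_1,\dots,A_d)(f)\in\mathbb C[[X_1,\dots,X_p]]$.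
   Context: $V$ is an $n$-dimensional complex vector space with coordinates $u_1,\dots,u_n$, $G\subset GL(V)$ finite, $\sigma_1,\dots,\sigma_m$ a fixed minimal system of homogeneous generators of $\mathbb C[V]^G$, $Z=\sigma(V)\subseteq\mathbb C^m$ with coordinate functions $w_j$, $\mathbb C[Z]=\mathbb C[V]^G$, $\pi=\sigma$. Invariant coordinates: $y_i=\sigma_{j_i}$ ($i=1,\dots,n$) with Jacobian $J=\det(\partial y_i/\partial u_a)\not\equiv0$; $z_i=w_{j_i}|_Z$. $\Delta_k$ is a $G$-invariant polynomial of minimal degree divisible by $J^k$ with the same zero set as $J$, $\tilde\Delta_k\circ\pi=\Delta_k$, $\tilde\Delta=\tilde\Delta_1$. With $(c_{ai})$ the inverse of $(\partial y_i/\partial u_a)$ and $D_i=\sum_a c_{ai}\partial/\partial u_a$, $\partial_Iv=\sum_aD_{i_1}\cdots D_{i_s}(u_a)e_a$ for $I=(i_1,\dots,i_s)$ and $\partial_\emptyset v=v$ (identity map). $\tau^s$ is the symmetric $d$-linear form with $\tau^s(w,\dots,w)=\tau(w)$; $\tilde T(I_1,\dots,I_d)$ is the rational function on $Z$ with $\tilde T(I_1,\dots,I_d)\circ\pi=\tau^s(\partial_{I_1}v,\dots,\partial_{I_d}v)$; its denominator can be taken to be a power of $\tilde\Delta$. A formal morphism from $\mathbb C^p$ to an affine variety $X$ is a $\mathbb C$-algebra homomorphism $\mathbb C[X]\to\mathbb C[[X_1,\dots,X_p]]$; for a rational function $\psi=\psi_1/\psi_2$ on $Z$ with $f(\psi_2)\ne0$,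 $f(\psi):=f(\psi_1)/f(\psi_2)$ in the fraction field $\mathbb C((X_1,\dots,X_p))$. Multi-indices $A=(a_1,\dots,a_s)$, $a_k\in\{1,\dots,p\}$, unordered, $|A|=s$, $\partial_A=\partial^s/\partial X_{a_1}\cdots\partial X_{a_s}$. $a_{A,I}$ ($A\ne\emptyset$, $1\le|I|\le|A|$) are the universal chain-rule polynomials: $\partial_A(\varphi\circ F)=\sum_{1\le|I|\le|A|}a_{A,I}((\partial_BF_i)_{i,B})(\partial_I\varphi)\circ F$ for all $\varphi$ and $F=(F_1,\dots,F_n)$. A formal morphism $F$ from $\mathbb C^p$ to $V$ is identified with an element of $V\otimes\mathbb C[[X_1,\dots,X_p]]$; $\mathfrak T$ is the $\mathbb C[[X]]$-multilinear extension of $\tau^s$ to $V\otimes\mathbb C[[X]]$, and $\mathfrak T(A_1,\dots,A_d)(F):=\mathfrak T(\partial_{A_1}F,\dots,\partial_{A_d}F)$. *)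

(* Defs.v *)
From HB Require Import structures.
From mathcomp Require Import all_boot all_order all_algebra.
From mathcomp Require Import boolp reals complex mpoly.

Set Implicit Arguments.
Unset Strict Implicit.
Unset Printing Implicit Defensive.

Import GRing.Theory Num.Theory.
Local Open Scope ring_scope.

Notation "x %:F" := (@FracField.tofrac _ x) : ring_scope.

Section FPS.
Variable R : idomainType.

Definition fps : Type := nat -> R.

HB.instance Definition _ := gen_eqMixin fps.
HB.instance Definition _ := gen_choiceMixin fps.

Definition fps0 : fps := fun _ => 0.
Definition fpsopp (a : fps) : fps := fun k => - a k.
Definition fpsadd (a b : fps) : fps := fun k => a k + b k.

Lemma fpsaddA : associative fpsadd.
Proof. by move=> a b c; apply: funext => k; rewrite /fpsadd addrA. Qed.
Lemma fpsaddC : commutative fpsadd.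
Proof. by move=> a b; apply: funext => k; rewrite /fpsadd addrC. Qed.
Lemma fpsadd0 : left_id fps0 fpsadd.
Proof. by move=> a; apply: funext => k; rewrite /fpsadd /fps0 add0r. Qed.
Lemma fpsaddN : left_inverse fps0 fpsopp fpsadd.
Proof. by move=> a; apply: funext => k; rewrite /fpsadd /fpsopp /fps0 addNr. Qed.

HB.instance Definition _ :=
  GRing.isZmodule.Build fps fpsaddA fpsaddC fpsadd0 fpsaddN.

Definition fps1 : fps := fun k => if k == 0%N then 1 else 0.
Definition fpsmul (a b : fps) : fps :=
  fun k => \sum_(j < k.+1) a j * b (k - j)%N.

Definition fpstr (N : nat) (a : fps) : {poly R} := \poly_(i < N) a i.

Lemma fpsmul_tr N a b k : (k < N)%N ->
  (fpstr N a * fpstr N b)`_k = fpsmul a b k.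
Proof.
move=> kN; rewrite coefM /fpsmul; apply: eq_bigr => j _.
rewrite !coef_poly; have jN : (j < N)%N by apply: leq_ltn_trans kN; rewrite -ltnS.
rewrite jN; have -> : (k - j < N)%N by apply: leq_ltn_trans (leq_subr _ _) kN.
by [].
Qed.

Lemma coefM_congr (p p' q q' : {poly R}) k :
  (forall j, (j <= k)%N -> p`_j = p'`_j) ->
  (forall j, (j <= k)%N -> q`_j = q'`_j) ->
  (p * q)`_k = (p' * q')`_k.
Proof.
move=> hp hq; rewrite !coefM; apply: eq_bigr => j _.
rewrite hp ?hq //; first exact: leq_subr.
by rewrite -ltnS.
Qed.

Lemma fpstr_mul N a b j : (j < N)%N ->
  (fpstr N (fpsmul a b))`_j = (fpstr N a * fpstr N b)`_j.
Proof. by move=> jN; rewrite coef_poly jN fpsmul_tr. Qed.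

Lemma fpsmulA : associative fpsmul.
Proof.
move=> a b c; apply: funext => k.
have kN : (k < k.+1)%N by [].
rewrite -(fpsmul_tr _ _ kN) -[RHS](fpsmul_tr _ _ kN).
have e1 : (fpstr k.+1 (fpsmul a b) * fpstr k.+1 c)`_k =
          (fpstr k.+1 a * fpstr k.+1 b * fpstr k.+1 c)`_k.
  apply: coefM_congr => // j jk; by rewrite fpstr_mul.
have e2 : (fpstr k.+1 a * fpstr k.+1 (fpsmul b c))`_k =
          (fpstr k.+1 a * (fpstr k.+1 b * fpstr k.+1 c))`_k.
  apply: coefM_congr => // j jk; by rewrite fpstr_mul.
by rewrite e1 e2 mulrA.
Qed.

Lemma fpsmulC : commutative fpsmul.
Proof.
move=> a b; apply: funext => k.
by rewrite -(@fpsmul_tr k.+1) // mulrC fpsmul_tr.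
Qed.

Lemma fpsmul1 : left_id fps1 fpsmul.
Proof.
move=> a; apply: funext => k; rewrite /fpsmul big_ord_recl /= /fps1 /= mul1r.
rewrite big1 ?addr0 ?subn0 // => i _; by rewrite mul0r.
Qed.

Lemma fpsmulDl : left_distributive fpsmul fpsadd.
Proof.
move=> a b c; apply: funext => k; rewrite /fpsmul /fpsadd -big_split /=.
by apply: eq_bigr => j _; rewrite mulrDl.
Qed.

Lemma fps1_neq0 : fps1 != fps0.
Proof.
apply/eqP => /(congr1 (fun f => f 0%N)); rewrite /fps1 /fps0 /=.
by move/eqP; rewrite oner_eq0.
Qed.

HB.instance Definition _ :=
  GRing.Zmodule_isComNzRing.Build fps fpsmulA fpsmulC fpsmul1 fpsmulDl fps1_neq0.

Definition fpsunit : {pred fps} := fun x => `[< exists y : fps, y * x = 1 >].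
Definition fpsinv (x : fps) : fps :=
  match pselect (exists y : fps, y * x = 1) with
  | left h => projT1 (cid h)
  | right _ => x
  end.

Lemma fpsmulVx : {in fpsunit, left_inverse 1 fpsinv *%R}.
Proof.
move=> x; rewrite unfold_in /fpsunit => /asboolP h; rewrite /fpsinv.
case: pselect => // h'; exact: (projT2 (cid h')).
Qed.

Lemma fpsunitPl x y : y * x = 1 -> fpsunit x.
Proof. by move=> h; rewrite /fpsunit; apply/asboolP; exists y. Qed.

Lemma fpsinv_out : {in [predC fpsunit], fpsinv =1 id}.
Proof.
move=> x; rewrite inE /= unfold_in /fpsunit => /asboolPn h; rewrite /fpsinv.
by case: pselect.
Qed.

HB.instance Definition _ :=
  GRing.ComNzRing_hasMulInverse.Build fps fpsmulVx fpsunitPl fpsinv_out.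

Lemma fps_nz_min (a : fps) : a != 0 ->
  exists i, a i != 0 /\ forall j, (j < i)%N -> a j = 0.
Proof.
move=> a0.
have ex : exists i, a i != 0.
  apply/not_existsP => h; move/eqP: a0; apply; apply: funext => i.
  have := h i; rewrite /GRing.zero /= /fps0.
  by case: (a i =P 0) => // /eqP ai /(_ ai).
case: (ex_minnP ex) => i ai hi; exists i; split => // j ji.
by apply: contraTeq ji => aj; rewrite -leqNgt hi.
Qed.

Lemma fps_idomain : GRing.integral_domain_axiom fps.
Proof.
move=> a b ab; apply/norP => -[a0 b0].
have [i [ai hi]] := fps_nz_min a0; have [j [bj hj]] := fps_nz_min b0.
have : (a * b) (i + j)%N = a i * b j.
  rewrite /GRing.mul /= /fpsmul.
  have iN : (i < (i + j).+1)%N by rewrite ltnS leq_addr.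
  rewrite (bigD1 (Ordinal iN)) //= addKn big1 ?addr0 // => k /eqP nki.
  have : (k : nat) != i by apply/eqP => ki; apply: nki; apply: val_inj.
  rewrite neq_ltn => /orP [ki|ik]; first by rewrite hi ?mul0r.
  rewrite hj ?mulr0 //.
  have := ltn_ord k; rewrite ltnS => kij.
  by rewrite ltn_subLR // ?ltn_add2r // (leq_trans (ltnW ik)).
rewrite ab /GRing.zero /= /fps0 => /esym/eqP.
by rewrite mulf_eq0 (negbTE ai) (negbTE bj).
Qed.

HB.instance Definition _ := GRing.ComUnitRing_isIntegral.Build fps fps_idomain.

Definition fpsderiv (a : fps) : fps := fun k => a k.+1 *+ k.+1.

Definition fpsC (c : R) : fps := fun k => if k == 0%N then c else 0.

End FPS.

(*    The variable X_(a+1) (a : 'I_p) is the outer variable of level a+1.   *)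

Fixpoint pser (K : idomainType) (p : nat) : idomainType :=
  match p with
  | 0%N => K
  | p'.+1 => GRing.IntegralDomain.clone (fps (pser K p')) _
  end.

Fixpoint pserC (K : idomainType) (p : nat) : K -> pser K p :=
  match p return K -> pser K p with
  | 0%N => fun c => c
  | p'.+1 => fun c => @fpsC (pser K p') (pserC p' c)
  end.

Fixpoint pserD (K : idomainType) (p : nat) : nat -> pser K p -> pser K p :=
  match p return nat -> pser K p -> pser K p with
  | 0%N => fun _ _ => 0
  | p'.+1 => fun a s =>
      if a == p' then @fpsderiv (pser K p') s
      else (fun k => pserD a ((s : fps (pser K p')) k)) : fps (pser K p')
  end.

Definition pserDA (K : idomainType) (p : nat) (A : seq 'I_p) (s : pser K p)
  : pser K p := foldr (fun (a : 'I_p) x => pserD (a : nat) x) s A.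

Section Invariants.
Variables (K : fieldType) (n : nat).

Definition finite_linear_group (G : seq 'M[K]_n) : Prop :=
  [/\ 1%:M \in G,
      forall g h, g \in G -> h \in G -> g *m h \in G
    & forall g, g \in G -> g \in unitmx].

Definition lin_comp (g : 'M[K]_n) (P : {mpoly K[n]}) : {mpoly K[n]} :=
  mmap (@mpolyC n K) (fun i => \sum_(j < n) g i j *: 'X_j) P.

Definition Ginvariant (G : seq 'M[K]_n) (P : {mpoly K[n]}) : Prop :=
  forall g, g \in G -> lin_comp g P = P.

Definition subst_gen (m : nat) (sigma : 'I_m -> {mpoly K[n]})
  (Q : {mpoly K[m]}) : {mpoly K[n]} := mmap (@mpolyC n K) sigma Q.

Definition min_hom_generators (G : seq 'M[K]_n) (m : nat)
  (sigma : 'I_m -> {mpoly K[n]}) : Prop :=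
  [/\ forall j, exists d : nat, sigma j \is d.-homog,
      forall j, Ginvariant G (sigma j),
      forall P, Ginvariant G P -> exists Q : {mpoly K[m]}, P = subst_gen sigma Q
    & forall j, ~ exists Q : {mpoly K[m]},
         (forall mo, mo \in msupp Q -> mo j = 0%N) /\ sigma j = subst_gen sigma Q].

(* Jacobian matrix (d y_i / d u_a)_(i,a) of the invariant coordinates
   y_i = sigma_(jj i) *)
Definition jac_mx (m : nat) (sigma : 'I_m -> {mpoly K[n]}) (jj : 'I_n -> 'I_m)
  : 'M[{mpoly K[n]}]_n := \matrix_(i, a) (sigma (jj i))^`M(a).

Definition jac (m : nat) (sigma : 'I_m -> {mpoly K[n]}) (jj : 'I_n -> 'I_m)
  : {mpoly K[n]} := \det (jac_mx sigma jj).

Definition is_Delta (G : seq 'M[K]_n) (J : {mpoly K[n]}) (k : nat)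
  (D : {mpoly K[n]}) : Prop :=
  [/\ Ginvariant G D,
      exists Q, D = J ^+ k * Q,
      forall v : 'I_n -> K, (D.@[v] == 0) = (J.@[v] == 0)
    & forall P, Ginvariant G P -> (exists Q, P = J ^+ k * Q) ->
        (forall v : 'I_n -> K, (P.@[v] == 0) = (J.@[v] == 0)) ->
        (msize D <= msize P)%N].

Local Notation FV := {fraction {mpoly K[n]}}.

Definition fderiv (a : 'I_n) (x : FV) : FV :=
  let r := repr x in
  (((\n_r)^`M(a) * \d_r - \n_r * (\d_r)^`M(a))%:F) / (((\d_r) ^+ 2)%:F).

Definition cmx (m : nat) (sigma : 'I_m -> {mpoly K[n]}) (jj : 'I_n -> 'I_m)
  : 'M[FV]_n := invmx (map_mx (fun P => P%:F) (jac_mx sigma jj)).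

Definition Dop (m : nat) (sigma : 'I_m -> {mpoly K[n]}) (jj : 'I_n -> 'I_m)
  (i : 'I_n) (x : FV) : FV :=
  \sum_(a < n) cmx sigma jj a i * fderiv a x.

Definition dIv (m : nat) (sigma : 'I_m -> {mpoly K[n]}) (jj : 'I_n -> 'I_m)
  (I : seq 'I_n) : 'I_n -> FV :=
  fun a => foldr (fun i x => Dop sigma jj i x) (('X_a : {mpoly K[n]})%:F) I.

(* an unordered multi-index over {1..n}, given by its multiplicities,
   listed as a (sorted) sequence *)
Definition cnt_seq (c : 'I_n -> nat) : seq 'I_n :=
  flatten [seq nseq (c i) i | i <- enum 'I_n].

(*    the unique symmetric d-linear form with tau^s(w,...,w) = tau(w),       *)
(*    with values in any commutative K-algebra T (given by e : K -> T).      *)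

Definition polar (T : comNzRingType) (e : K -> T) (tau : {mpoly K[n]}) (d : nat)
  (w : 'I_d -> 'I_n -> T) : T :=
  e (d`!%:R^-1) *
  \sum_(a : {ffun 'I_d -> 'I_n})
     e ((foldr (fun k P => P^`M(a k)) tau (enum 'I_d))@_0%MM) *
     \prod_(k < d) w k (a k).

End Invariants.

Section Formal.
Variables (K : fieldType) (n p : nat).
Local Notation S := (pser K p).
Local Notation FV := {fraction {mpoly K[n]}}.
Local Notation FS := {fraction S}.

Definition formal_morV (F : 'I_n -> S) : {mpoly K[n]} -> S :=
  fun P => mmap (@pserC K p) F P.

(* f : C[Z] = C[V]^G -> K[[X]] is a K-algebra homomorphism (a formal
   morphism from K^p to Z); only its values on invariants matter. *)
Definition formal_morZ (G : seq 'M[K]_n) (f : {mpoly K[n]} -> S) : Prop :=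
  [/\ forall P Q, Ginvariant G P -> Ginvariant G Q -> f (P + Q) = f P + f Q,
      forall P Q, Ginvariant G P -> Ginvariant G Q -> f (P * Q) = f P * f Q
    & forall c : K, f c%:MP = pserC p c].

(* f(psi) = f(psi_1)/f(psi_2) for a rational function psi = psi_1/psi_2 on Z
   (psi_1, psi_2 in C[Z] = C[V]^G, with f(psi_2) <> 0); psi is given through
   its pull-back psi o pi in the field of rational functions on V. *)
Definition fapp_rep (G : seq 'M[K]_n) (f : {mpoly K[n]} -> S) (psi : FV)
  (q : FS) : Prop :=
  exists psi1 psi2 : {mpoly K[n]},
    [/\ Ginvariant G psi1, Ginvariant G psi2, f psi2 != 0,
        psi = psi1%:F / psi2%:F & q = (f psi1)%:F / (f psi2)%:F].

Definition fapp (G : seq 'M[K]_n) (f : {mpoly K[n]} -> S) (psi : FV) : FS :=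
  match pselect (exists q, fapp_rep G f psi q) with
  | left h => projT1 (cid h)
  | right _ => 0
  end.

(* a_(A,I)((d_B g_i)_(i,B)), the universal chain-rule polynomials
   evaluated at the derivatives of g = (g_1,...,g_n) (here g_i = f(z_i)),
   with I an unordered multi-index given by multiplicities.  They are
   characterized by d_A(phi o g) = sum_I a_(A,I)(...) (d_I phi) o g, and
   are computed by differentiating this identity:
     a_(a::A, I) = d_a a_(A,I) + sum_(j, I_j > 0) (d_a g_j) a_(A, I - e_j). *)
Fixpoint chain_coef (g : 'I_n -> S) (A : seq 'I_p) (I : 'I_n -> nat) : S :=
  match A with
  | [::] => if [forall i, I i == 0%N] then 1 else 0
  | a :: A' =>
      pserD (a : nat) (chain_coef g A' I) +
      \sum_(j < n | (0 < I j)%N)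
         pserD (a : nat) (g j) *
         chain_coef g A' (fun i => if i == j then (I i).-1 else I i)
  end.

(* tilde-frak-T(A_1,...,A_d)(f).  The multi-indices I_1..I_d' are encoded by
   multiplicity vectors with entries bounded by N = sum_k |A_k| (which bounds
   every |A_k|); the entries of unused I_k (k >= d') are 0, i.e. empty. *)
Definition tTfrak (G : seq 'M[K]_n) (m : nat) (sigma : 'I_m -> {mpoly K[n]})
  (jj : 'I_n -> 'I_m) (tau : {mpoly K[n]}) (d d' : nat) (A : 'I_d -> seq 'I_p)
  (f : {mpoly K[n]} -> S) : FS :=
  let N := (\sum_(k < d) size (A k))%N in
  let g := fun i => f (sigma (jj i)) in
  \sum_(I : {ffun 'I_d -> {ffun 'I_n -> 'I_N.+1}} |
          [forall k : 'I_d,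
             if (k < d')%N then
               (1 <= \sum_(i < n) (I k i : nat) <= size (A k))%N
             else [forall i, (I k i : nat) == 0%N]])
    (\prod_(k < d | (k < d')%N) chain_coef g (A k) (fun i => I k i))%:F *
    fapp G f (polar (fun c : K => (c%:MP)%:F) tau
                (fun k => dIv sigma jj (cnt_seq (fun i => I k i)))).

Definition Tfrak (tau : {mpoly K[n]}) (d : nat) (A : 'I_d -> seq 'I_p)
  (F : 'I_n -> S) : S :=
  polar (@pserC K p) tau (fun k a => pserDA (A k) (F a)).

End Formal.

(* Main.v *)
Require Import Defs.
From HB Require Import structures.
From mathcomp Require Import all_boot all_order all_algebra.
From mathcomp Require Import boolp reals complex mpoly ring zify.
Import GRing.Theory Num.Theory.
Local Open Scope ring_scope.

(* Write J for the Jacobian.  The operators D_i are commuting derivations of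
   C(V), dual to the coordinates y_i.  For (1), a formal morphism F to V with
   F(J) <> 0 extends to the rational functions whose denominator it does not
   kill, and iterating the chain rule
     d_a F(x) = sum_i d_a F(y_i) F(D_i x)
   expresses d_A F_a through the F(D_I u_a); then expand tau^s multilinearly.
   For (2), each D_i raises the pole order along J by at most 2, and D_i u_a has
   a simple pole, so d_I v has a pole of order at most 2|I| - 1 and Delta_M
   cancels every denominator of T~(I_1,...,I_d).  Since D_i commutes with G and
   tau^s is G-invariant, Delta_M T~ is an invariant polynomial, to which f
   applies. *)

Set Implicit Arguments.
Unset Strict Implicit.
Unset Printing Implicit Defensive.

(** * Derivations and fraction fields *)

Section Derivations.
Variable B : comNzRingType.

Definition derivation (D : B -> B) : Prop :=
  (forall x y, D (x + y) = D x + D y) /\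
  (forall x y, D (x * y) = D x * y + x * D y).

Variables (D : B -> B) (derD : derivation D).

Lemma der0 : D 0 = 0.
Proof. by apply: (addrI (D 0)); rewrite -derD.1 !addr0. Qed.

Lemma der1 : D 1 = 0.
Proof.
by apply: (addrI (D 1)); rewrite addr0 -{3}(mulr1 1) derD.2 mulr1 mul1r.
Qed.

Lemma der_sum (I : Type) (r : seq I) (P : pred I) (F : I -> B) :
  D (\sum_(i <- r | P i) F i) = \sum_(i <- r | P i) D (F i).
Proof. exact: (big_morph D derD.1 der0). Qed.

Lemma derXn x k : D (x ^+ k.+1) = x ^+ k * D x *+ k.+1.
Proof.
elim: k => [|k IH]; first by rewrite expr0 mul1r.
rewrite exprS derD.2 IH -mulrnAr mulrA -exprS -mulrnAr mulrC.
by rewrite [in RHS]mulrS mulrDr.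
Qed.

End Derivations.

(** [fderiv] is computed on the representative picked by [repr]; this equation is the bridge from
    that representative to arbitrary numerators and denominators. *)
Lemma frac_repr (B : idomainType) (x : {fraction B}) :
  x = (\n_(repr x))%:F / (\d_(repr x))%:F.
Proof.
have d0 : (\d_(repr x))%:F != 0 :> {fraction B} by rewrite tofrac_eq0 denom_ratioP.
apply: (mulIf d0); rewrite mulfVK // -{1}(reprK x).
rewrite -[X in _ * X]/(FracField.tofrac _); unlock FracField.tofrac.
rewrite !piE; apply/eqmodP => /=.
rewrite FracField.equivfE /FracField.mulf.
rewrite !(numer_Ratio _ (oner_neq0 _), denom_Ratio _ (oner_neq0 _)).
by rewrite mulr1 !(numer_Ratio, denom_Ratio) ?denom_ratioP ?mulr1 ?denom_ratioP // mulrC.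
Qed.

Lemma fracP (B : idomainType) (x : {fraction B}) :
  exists P Q : B, Q != 0 /\ x = P%:F / Q%:F.
Proof.
exists (\n_(repr x)), (\d_(repr x)); split; first exact: denom_ratioP.
exact: frac_repr.
Qed.

Lemma eq_frac (B : idomainType) (P Q P' Q' : B) : Q != 0 -> Q' != 0 ->
  (P%:F / Q%:F == P'%:F / Q'%:F :> {fraction B}) = (P * Q' == P' * Q).
Proof.
by move=> Q0 Q'0; rewrite eqr_div ?tofrac_eq0 // -!tofracM tofrac_eq.
Qed.

Section FracDerivation.
Variables (B : idomainType) (D : B -> B).
Hypothesis derD : derivation D.

(* [fderiv a] is literally [fracD (mderiv a)]. *)
Definition fracD (x : {fraction B}) : {fraction B} :=
  let r := repr x in
  ((D \n_r * \d_r - \n_r * D \d_r)%:F) / ((\d_r ^+ 2)%:F).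

(** The quotient rule does not depend on the chosen fraction: two presentations satisfy a
    cross-multiplied relation [E], and applying [D] to it gives the second relation [E'] that is
    needed. *)
Lemma fracD_frac P Q : Q != 0 ->
  fracD (P%:F / Q%:F) = (D P * Q - P * D Q)%:F / (Q ^+ 2)%:F.
Proof.
move=> Q0; rewrite /fracD; set r := repr _.
have d0 : \d_r != 0 by exact: denom_ratioP.
have /eqP := frac_repr (P%:F / Q%:F); rewrite -/r eq_frac // => /eqP E.
have E' : D P * \d_r + P * D \d_r = D \n_r * Q + \n_r * D Q.
  by rewrite -!derD.2 E.
apply/eqP; rewrite eq_frac ?expf_neq0 //; apply/eqP.
move: E E'; set a := \n_r; set b := \d_r => E E'.
(* Regrouped so that [a] and [D a] occur only through the right-hand sides of [E] and [E']. *)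
have -> : (D a * b - a * D b) * Q ^+ 2 =
   b * Q * (D a * Q + a * D Q) - b * D Q * (a * Q) - D b * Q * (a * Q) by ring.
by rewrite -E' -E; ring.
Qed.

Lemma fracD_tofrac P : fracD P%:F = (D P)%:F.
Proof.
have {1}-> : P%:F = P%:F / 1%:F :> {fraction B} by rewrite tofrac1 divr1.
rewrite fracD_frac ?oner_neq0 // (der1 derD) !mulr1 mulr0 subr0 expr1n.
by rewrite tofrac1 divr1.
Qed.

Lemma fracD_derivation : derivation fracD.
Proof.
split=> x y.
  have [P [Q [Q0 ->]]] := fracP x; have [P' [Q' [Q'0 ->]]] := fracP y.
  rewrite addf_div ?tofrac_eq0 // -!tofracM -tofracD !fracD_frac ?mulf_neq0 //.
  rewrite addf_div ?tofrac_eq0 ?expf_neq0 // -!tofracM -tofracD.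
  apply/eqP; rewrite eq_frac ?mulf_neq0 ?expf_neq0 //; apply/eqP.
  by rewrite !derD.1 !derD.2; ring.
have [P [Q [Q0 ->]]] := fracP x; have [P' [Q' [Q'0 ->]]] := fracP y.
rewrite mulf_div -!tofracM !fracD_frac ?mulf_neq0 //.
rewrite !mulf_div -!tofracM.
rewrite addf_div ?tofrac_eq0 ?mulf_neq0 ?expf_neq0 // -!tofracM -tofracD.
apply/eqP; rewrite eq_frac ?mulf_neq0 ?expf_neq0 //; apply/eqP.
by rewrite !derD.2; ring.
Qed.

End FracDerivation.

(** * Extending a ring morphism to fractions *)

Section FractionValues.
Variables (A B : idomainType) (phi : {rmorphism A -> B}).
Local Notation FA := {fraction A}.
Local Notation FB := {fraction B}.

(** [phi] may have a kernel, so it extends only to the localization of [A] at that prime ideal. The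
    extension is handled as a relation, which composes well with sums and products; [fval] makes it
    total with default 0. *)
Definition fval_rep (x : FA) (q : FB) : Prop :=
  exists P Q : A, [/\ phi Q != 0, x = P%:F / Q%:F & q = (phi P)%:F / (phi Q)%:F].

Definition fval_def (x : FA) : Prop := exists q, fval_rep x q.

Definition fval (x : FA) : FB :=
  if pselect (fval_def x) is left h then projT1 (cid h) else 0.

Lemma rmorph_neq0 Q : phi Q != 0 -> Q != 0.
Proof. by apply: contra => /eqP ->; rewrite rmorph0. Qed.

Lemma fval_rep_uniq x q q' : fval_rep x q -> fval_rep x q' -> q = q'.
Proof.
move=> [P [Q [Q0 -> ->]]] [P' [Q' [Q'0 /eqP E ->]]]; apply/eqP.
move: E; rewrite !eq_frac ?rmorph_neq0 // => /eqP E.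
by rewrite -!rmorphM E.
Qed.

Lemma fvalP x : fval_def x -> fval_rep x (fval x).
Proof. by rewrite /fval; case: pselect => // h _; exact: projT2 (cid h). Qed.

Lemma fvalE x q : fval_rep x q -> fval x = q.
Proof. by move=> xq; apply: (fval_rep_uniq _ xq); apply: fvalP; exists q. Qed.

Lemma fval_frac_rep P Q :
  phi Q != 0 -> fval_rep (P%:F / Q%:F) ((phi P)%:F / (phi Q)%:F).
Proof. by move=> Q0; exists P, Q. Qed.

Lemma fval_tofrac_rep P : fval_rep P%:F (phi P)%:F.
Proof.
exists P, 1; split; rewrite ?rmorph1 ?oner_neq0 //.
  by rewrite divr1.
by rewrite divr1.
Qed.

Lemma fvalD_rep x y q r :
  fval_rep x q -> fval_rep y r -> fval_rep (x + y) (q + r).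
Proof.
move=> [P [Q [Q0 -> ->]]] [P' [Q' [Q'0 -> ->]]].
exists (P * Q' + P' * Q), (Q * Q'); split.
- by rewrite rmorphM mulf_neq0.
- by rewrite addf_div ?tofrac_eq0 ?rmorph_neq0 // -!tofracM -tofracD.
- by rewrite addf_div ?tofrac_eq0 // -!tofracM -tofracD !(rmorphD, rmorphM).
Qed.

Lemma fvalM_rep x y q r :
  fval_rep x q -> fval_rep y r -> fval_rep (x * y) (q * r).
Proof.
move=> [P [Q [Q0 -> ->]]] [P' [Q' [Q'0 -> ->]]].
exists (P * P'), (Q * Q'); split.
- by rewrite rmorphM mulf_neq0.
- by rewrite mulf_div -!tofracM.
- by rewrite mulf_div -!tofracM !rmorphM.
Qed.

Lemma fval_sum_rep (I : Type) (r : seq I) (P : pred I) (F : I -> FA) (F' : I -> FB) :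
  (forall i, P i -> fval_rep (F i) (F' i)) ->
  fval_rep (\sum_(i <- r | P i) F i) (\sum_(i <- r | P i) F' i).
Proof.
move=> H; apply: (big_ind2 fval_rep) => //.
- by have := fval_tofrac_rep 0; rewrite !rmorph0.
- by move=> x y q s; exact: fvalD_rep.
Qed.

Lemma fval_prod_rep (I : Type) (r : seq I) (P : pred I) (F : I -> FA) (F' : I -> FB) :
  (forall i, P i -> fval_rep (F i) (F' i)) ->
  fval_rep (\prod_(i <- r | P i) F i) (\prod_(i <- r | P i) F' i).
Proof.
move=> H; apply: (big_ind2 fval_rep) => //.
- by have := fval_tofrac_rep 1; rewrite !rmorph1.
- by move=> x y q s; exact: fvalM_rep.
Qed.

End FractionValues.

(** * Power series and polynomials *)

Section PowerSeries.
Variable R : idomainType.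

Lemma fpsE_add (a b : fps R) k : (a + b) k = a k + b k.
Proof. by []. Qed.

Lemma fpsE_mul (a b : fps R) k : (a * b) k = \sum_(j < k.+1) a j * b (k - j)%N.
Proof. by []. Qed.

Lemma fpsC_is_zmod_morphism : zmod_morphism (@fpsC R).
Proof.
move=> c c'; apply: funext => k.
transitivity (fpsC c k - fpsC c' k) => //; rewrite /fpsC.
by case: (k == 0%N); rewrite ?subr0.
Qed.

Lemma fpsC_is_monoid_morphism : monoid_morphism (@fpsC R).
Proof.
split=> // c c'; apply: funext => k.
rewrite [RHS]fpsE_mul big_ord_recl /= subn0 big1 ?addr0 => [|j _].
  by rewrite /fpsC; case: (k == 0%N); rewrite ?mulr0.
by rewrite /fpsC /= mul0r.
Qed.

Lemma fpsderiv_derivation : derivation (@fpsderiv R).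
Proof.
split=> a b; apply: funext => k; first exact: mulrnDl.
rewrite [RHS]fpsE_add !fpsE_mul.
(* The Leibniz rule is borrowed from polynomials by truncation. Coefficient [k] of a derivative
   reads coefficient [k.+1], hence the cut at [k.+2]. *)
have tr (c : fps R) j : (j < k.+2)%N -> (fpstr k.+2 c)`_j = c j.
  by rewrite coef_poly => ->.
have trD (c : fps R) j : (j < k.+1)%N -> ((fpstr k.+2 c)^`())`_j = fpsderiv c j.
  by move=> jk; rewrite coef_deriv tr.
transitivity ((fpstr k.+2 a * fpstr k.+2 b)^`()`_k).
  by rewrite coef_deriv fpsmul_tr.
rewrite derivM coefD !coefM; congr (_ + _); apply: eq_bigr => j _.
  by rewrite trD // tr // ltnS (leq_trans (leq_subr _ _)).
by rewrite tr ?ltnS ?(leq_trans (ltnW (ltn_ord j))) // trD // ltnS leq_subr.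
Qed.

Lemma fps_map_derivation (D : R -> R) :
  derivation D -> derivation (fun (a : fps R) => (fun k => D (a k)) : fps R).
Proof.
move=> derD; split=> a b; apply: funext => k; first exact: derD.1.
rewrite [RHS]fpsE_add !fpsE_mul (der_sum derD) -big_split /=.
by apply: eq_bigr => j _; rewrite derD.2.
Qed.

End PowerSeries.

Section IteratedPowerSeries.
Variable K : idomainType.

Lemma pserC_is_zmod_morphism p : zmod_morphism (@pserC K p).
Proof.
elim: p => [//|p IH] c c' /=.
by rewrite IH; exact: fpsC_is_zmod_morphism.
Qed.

Lemma pserC_is_monoid_morphism p : monoid_morphism (@pserC K p).
Proof.
elim: p => [//|p [IH1 IHM]]; split=> [|c c'] /=.
  by rewrite IH1.
by rewrite IHM; exact: (fpsC_is_monoid_morphism _).2.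
Qed.

HB.instance Definition _ p :=
  GRing.isZmodMorphism.Build K (pser K p) (@pserC K p) (@pserC_is_zmod_morphism p).
HB.instance Definition _ p :=
  GRing.isMonoidMorphism.Build K (pser K p) (@pserC K p)
    (@pserC_is_monoid_morphism p).

Lemma pserD_derivation p a : derivation (@pserD K p a).
Proof.
elim: p a => [|p IH] a /=.
  by split=> x y; rewrite ?mul0r ?mulr0 addr0.
case: (a == p); first exact: fpsderiv_derivation.
exact: fps_map_derivation.
Qed.

Lemma pserDC p a c : @pserD K p a (pserC p c) = 0.
Proof.
elim: p a c => [//|p IH] a c /=.
case: (a == p); apply: funext => k /=.
  by rewrite /fpsderiv /fpsC /= mul0rn.
rewrite /fpsC; case: (k == 0%N); first exact: IH.
by rewrite (der0 (pserD_derivation p a)).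
Qed.

End IteratedPowerSeries.

Section Polynomials.
Variables (K : fieldType) (n : nat).

Lemma mpoly_ring_ind (P : {mpoly K[n]} -> Prop) :
  (forall c, P c%:MP) -> (forall i, P 'X_i) ->
  (forall p q, P p -> P q -> P (p + q)) ->
  (forall p q, P p -> P q -> P (p * q)) -> forall p, P p.
Proof.
move=> PC PX PD PM p; rewrite (mpolyE p).
apply: (big_ind P) => [|p1 p2|m _]; [by rewrite -mpolyC0|exact: PD|].
rewrite -mul_mpolyC; apply: (PM _ _ (PC _)).
rewrite mpolyXE_id; apply: (big_ind P) => [|p1 p2|i _].
- by rewrite -mpolyC1.
- exact: PM.
- by elim: (m i) => [|k IH]; [rewrite expr0 -mpolyC1|rewrite exprS; apply: PM].
Qed.

Lemma mderiv_derivation (a : 'I_n) : derivation (@mderiv n K a).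
Proof. by split=> [x y|x y]; [rewrite mderivD|rewrite mderivM]. Qed.

Lemma mderivX1 (a b : 'I_n) : ('X_b : {mpoly K[n]})^`M(a) = (b == a)%:R.
Proof.
rewrite mderivX mnm1E; case: eqP => [->|_]; last by rewrite scale0r.
rewrite scale1r -[RHS]mpolyX0; congr ('X_[_]).
by apply/mnmP => i; rewrite mnmBE mnm0E subnn.
Qed.

Section Chain.
Variables (B : idomainType) (phi : {rmorphism {mpoly K[n]} -> B}) (D : B -> B).
Hypothesis derD : derivation D.
Hypothesis D_const : forall c : K, D (phi c%:MP) = 0.

(** Both sides are additive in [P], obey the Leibniz rule over [phi], and agree on constants and
    variables. *)
Lemma chain_mpoly P :
  D (phi P) = \sum_(b < n) D (phi 'X_b) * phi P^`M(b).
Proof.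
elim/mpoly_ring_ind: P => [c|i|p q IHp IHq|p q IHp IHq].
- by rewrite D_const big1 // => b _; rewrite mderivC rmorph0 mulr0.
- rewrite (bigD1 i) //= mderivX1 eqxx rmorph1 mulr1 big1 ?addr0 // => b bi.
  by rewrite mderivX1 eq_sym (negbTE bi) rmorph0 mulr0.
- rewrite rmorphD derD.1 IHp IHq -big_split /=; apply: eq_bigr => b _.
  by rewrite mderivD rmorphD mulrDr.
- rewrite rmorphM derD.2 IHp IHq mulr_suml mulr_sumr -big_split /=.
  apply: eq_bigr => b _; rewrite mderivM !(rmorphD, rmorphM); ring.
Qed.

Lemma fderivE (a : 'I_n) : @fderiv K n a = fracD (@mderiv n K a).
Proof. by []. Qed.

Lemma fval_fderiv_def b x : fval_def phi x -> fval_def phi (fderiv b x).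
Proof.
move=> [_ [P [Q [Q0 -> _]]]]; rewrite fderivE fracD_frac; first last.
- exact: rmorph_neq0 Q0.
- exact: mderiv_derivation.
by eexists; apply: fval_frac_rep; rewrite rmorphXn expf_neq0.
Qed.

Lemma chain_fval x : fval_def phi x ->
  fracD D (fval phi x) =
  \sum_(b < n) (D (phi 'X_b))%:F * fval phi (fderiv b x).
Proof.
move=> [_ [P [Q [Q0 -> _]]]].
rewrite (fvalE (fval_frac_rep P Q0)) fracD_frac //.
under eq_bigr => b _ do
  rewrite fderivE (fracD_frac (mderiv_derivation b)) ?(rmorph_neq0 Q0) //
    (fvalE (fval_frac_rep _ _)) ?rmorphXn ?expf_neq0 // mulrA.
rewrite -mulr_suml tofracXn; congr (_ / _).
under eq_bigr => b _ do rewrite -tofracM.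
rewrite -(rmorph_sum (@FracField.tofrac B)); congr (_%:F).
rewrite !chain_mpoly mulr_suml mulr_sumr -sumrB.
by apply: eq_bigr => b _; rewrite !(rmorphB, rmorphM); ring.
Qed.

End Chain.
End Polynomials.

(** * The operators D_i and the chain rule *)

Section InvariantCoordinates.
Variables (K : fieldType) (n m : nat).
Variables (sigma : 'I_m -> {mpoly K[n]}) (jj : 'I_n -> 'I_m).
Hypothesis jac_neq0 : jac sigma jj != 0.
Local Notation FV := {fraction {mpoly K[n]}}.
Local Notation y i := (sigma (jj i)).
Local Notation Dop := (Dop sigma jj).
Local Notation cmx := (cmx sigma jj).
Local Notation jacF := (map_mx (fun P => P%:F) (jac_mx sigma jj) : 'M[FV]_n).

Lemma det_jacF : \det jacF = (jac sigma jj)%:F.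
Proof. exact: (det_map_mx (@FracField.tofrac {mpoly K[n]})). Qed.

Lemma jacF_unit : jacF \in unitmx.
Proof. by rewrite unitmxE det_jacF unitfE tofrac_eq0. Qed.

(** Cramer's rule: the only denominator in the inverse Jacobian matrix is [jac], to the first power.
    This controls both where [Dop] can be evaluated and how fast poles grow. *)
Lemma cmxE a i : cmx a i = (\adj (jac_mx sigma jj) a i)%:F / (jac sigma jj)%:F.
Proof.
rewrite /Defs.cmx /invmx jacF_unit det_jacF.
by rewrite -(map_mx_adj (@FracField.tofrac {mpoly K[n]})) !mxE mulrC.
Qed.

Lemma fderiv_derivation a : derivation (@fderiv K n a).
Proof. exact: fracD_derivation (mderiv_derivation K a). Qed.

Lemma fderiv_tofrac a P : @fderiv K n a P%:F = (P^`M(a))%:F.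
Proof. exact: fracD_tofrac (mderiv_derivation K a) P. Qed.

Lemma Dop_derivation i : derivation (Dop i).
Proof.
split=> x z; rewrite /Defs.Dop.
  rewrite -big_split; apply: eq_bigr => a _.
  by rewrite (fderiv_derivation a).1 mulrDr.
rewrite mulr_suml mulr_sumr -big_split; apply: eq_bigr => a _.
by rewrite (fderiv_derivation a).2 /=; ring.
Qed.

Lemma Dop_const i c : Dop i (c%:MP)%:F = 0.
Proof.
by apply: big1 => a _; rewrite fderiv_tofrac mderivC tofrac0 mulr0.
Qed.

Lemma Dop_coord i j : Dop i (y j)%:F = (j == i)%:R.
Proof.
transitivity ((jacF *m cmx) j i); last by rewrite mulmxV ?jacF_unit // mxE.
rewrite mxE; apply: eq_bigr => a _.
by rewrite fderiv_tofrac !mxE mulrC.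
Qed.

Lemma fderiv_Dop b x : fderiv b x = \sum_(i < n) ((y i)^`M(b))%:F * Dop i x.
Proof.
under eq_bigr => i _ do rewrite mulr_sumr.
rewrite exchange_big /=.
under eq_bigr => a _.
  under eq_bigr => i _.
    rewrite mulrA (mulrC (_%:F)).
    rewrite (_ : cmx a i * _ = cmx a i * jacF i b); last by rewrite !mxE.
    over.
  rewrite -mulr_suml (_ : \sum_i _ = (cmx *m jacF) a b); last by rewrite [RHS]mxE.
  rewrite mulVmx ?jacF_unit // mxE.
  over.
rewrite (bigD1 b) //= eqxx mul1r big1 ?addr0 // => a /negbTE ->.
by rewrite mul0r.
Qed.

(* The Jacobian is invertible over the fraction field, so the coordinates
   [y i] determine a derivation. *)
Lemma derivation_coord_eq0 (E : FV -> FV) :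
  derivation E -> (forall c, E (c%:MP)%:F = 0) ->
  (forall i, E (y i)%:F = 0) -> forall x, E x = 0.
Proof.
move=> derE EC Ey.
have chE P : E P%:F = \sum_(b < n) E ('X_b)%:F * (P^`M(b))%:F.
  exact: (chain_mpoly (phi := @FracField.tofrac {mpoly K[n]}) derE EC).
have e0 : (\col_b E ('X_b)%:F : 'cV[FV]_n) = 0.
  rewrite -[LHS]mul1mx -(mulVmx jacF_unit) -mulmxA [X in _ *m X](_ : _ = 0) ?mulmx0 //.
  apply/matrixP => i k; rewrite !mxE -[RHS](Ey i) chE.
  by apply: eq_bigr => b _; rewrite !mxE mulrC.
have EX b : E ('X_b)%:F = 0 by move/matrixP/(_ b 0): e0; rewrite !mxE.
have EP P : E P%:F = 0 by rewrite chE big1 // => b _; rewrite EX mul0r.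
move=> x; have [P [Q [Q0 xPQ]]] := fracP x.
have QF0 : Q%:F != 0 :> FV by rewrite tofrac_eq0.
have := EP P; rewrite -[P%:F](mulfVK QF0) -xPQ derE.2 EP mulr0 addr0.
by move/eqP; rewrite mulf_eq0 (negbTE QF0) orbF => /eqP.
Qed.

(** The commutator of two derivations is again a derivation. It kills constants, and it kills each
    coordinate because [Dop_coord] makes the first derivatives constant. *)
Lemma Dop_comm i j x : Dop i (Dop j x) = Dop j (Dop i x).
Proof.
have di := Dop_derivation i; have dj := Dop_derivation j.
apply/eqP; rewrite -subr_eq0; apply/eqP.
apply: (@derivation_coord_eq0 (fun x => Dop i (Dop j x) - Dop j (Dop i x))).
- split=> u v; first by rewrite dj.1 di.1 di.1 dj.1; ring.
  by rewrite dj.2 di.1 !di.2 dj.1 !dj.2; ring.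
- by move=> c; rewrite !Dop_const subrr.
- move=> k; rewrite !Dop_coord.
  have D01 (b : bool) l : Dop l b%:R = 0.
    by case: b; rewrite ?(der1 (Dop_derivation l)) ?(der0 (Dop_derivation l)).
  by rewrite !D01 subrr.
Qed.

(** This lets [dIv] depend only on the multiplicities of an index, as unordered multi-indices
    require. *)
Lemma foldr_Dop_perm s t x : perm_eq s t -> foldr Dop x s = foldr Dop x t.
Proof.
have rem_head i u : i \in u -> foldr Dop x u = Dop i (foldr Dop x (rem i u)).
  elim: u => //= k u IH; case: eqVneq => [->|ki] //.
  by rewrite inE eq_sym (negbTE ki) /= => /IH ->; rewrite Dop_comm.
elim: s t => [|i s IH] t; first by rewrite perm_sym => /perm_nilP ->.
move=> st; have it : i \in t by rewrite -(perm_mem st) mem_head.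
rewrite (rem_head _ _ it) /= (IH (rem i t)) //.
by rewrite -(perm_cons i) (perm_trans st) // perm_to_rem.
Qed.

Lemma count_cnt_seq (c : 'I_n -> nat) i : count_mem i (cnt_seq c) = c i.
Proof.
rewrite /cnt_seq count_flatten -map_comp sumnE big_map big_enum /=.
rewrite (bigD1 i) //= count_nseq /= eqxx mul1n big1 ?addn0 // => k ki.
by rewrite count_nseq /= (negbTE ki).
Qed.

Lemma size_cnt_seq (c : 'I_n -> nat) : size (cnt_seq c) = (\sum_i c i)%N.
Proof.
rewrite /cnt_seq size_flatten sumnE /shape -map_comp big_map big_enum /=.
by apply: eq_bigr => i _; rewrite size_nseq.
Qed.

Lemma Dop_cnt_seq j (I : 'I_n -> nat) x :
  Dop j (foldr Dop x (cnt_seq I)) =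
  foldr Dop x (cnt_seq (fun i => if i == j then (I i).+1 else I i)).
Proof.
rewrite -[LHS]/(foldr Dop x (j :: cnt_seq I)); apply: foldr_Dop_perm.
apply/allP => i _ /=; rewrite !count_cnt_seq (eq_sym j i).
by case: (i == j).
Qed.

Section Values.
Variables (B : idomainType) (phi : {rmorphism {mpoly K[n]} -> B}) (D : B -> B).
Hypothesis phi_jac : phi (jac sigma jj) != 0.

Lemma fval_Dop_def i x : fval_def phi x -> fval_def phi (Dop i x).
Proof.
move=> dx; eexists; apply: fval_sum_rep => a _.
apply: fvalM_rep; last exact: fvalP (fval_fderiv_def a dx).
by rewrite cmxE; exact: fval_frac_rep.
Qed.

Lemma fval_foldr_Dop_def s x :
  fval_def phi x -> fval_def phi (foldr Dop x s).
Proof. by move=> dx; elim: s => //= i s IH; exact: fval_Dop_def. Qed.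

Hypothesis derD : derivation D.
Hypothesis D_const : forall c : K, D (phi c%:MP) = 0.

(** Both sides are expanded in the linear coordinates; they match because [fderiv_Dop] writes each
    partial derivative in terms of the [Dop i]. *)
Lemma chain_fval_Dop x : fval_def phi x ->
  fracD D (fval phi x) =
  \sum_(i < n) (D (phi (y i)))%:F * fval phi (Dop i x).
Proof.
move=> dx; rewrite (chain_fval derD D_const dx).
under [RHS]eq_bigr => i _ do
  rewrite (chain_mpoly derD D_const) raddf_sum mulr_suml.
rewrite exchange_big; apply: eq_bigr => b _ /=.
under [RHS]eq_bigr => i _ do rewrite tofracM -mulrA.
rewrite -mulr_sumr; congr (_ * _); apply: fvalE.
rewrite fderiv_Dop; apply: fval_sum_rep => i _.
by apply: fvalM_rep; [exact: fval_tofrac_rep|exact/fvalP/fval_Dop_def].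
Qed.

End Values.
End InvariantCoordinates.

(** * The universal chain-rule polynomials *)

Section ChainCoef.
Variables (K : fieldType) (n p : nat) (g : 'I_n -> pser K p).

Lemma sum_decr (I : 'I_n -> nat) j : (0 < I j)%N ->
  ((\sum_i (if i == j then (I i).-1 else I i)).+1 = \sum_i I i)%N.
Proof.
move=> Ij; rewrite (bigD1 j) //= [RHS](bigD1 j) //= eqxx.
rewrite -[in RHS](prednK Ij) addSn; congr (_ + _).+1%N.
by apply: eq_bigr => i /negbTE ->.
Qed.

Lemma chain_coef_gt A (I : 'I_n -> nat) :
  (size A < \sum_i I i)%N -> chain_coef g A I = 0.
Proof.
elim: A I => [|a A IH] I /= sI.
  case: forallP => // I0; move: sI; rewrite big1 // => i _.
  exact/eqP/I0.
rewrite IH ?(ltnW sI) // (der0 (pserD_derivation _ _ _)) add0r big1 // => j Ij.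
by rewrite IH ?mulr0 // -ltnS sum_decr.
Qed.

(** At the zero index the inner sum of the recursion is empty, so only derivatives of the initial 1
    remain. With [chain_coef_gt] this confines the chain rule to indices of size between 1 and the
    size of [A]. *)
Lemma chain_coef_0 A (I : 'I_n -> nat) :
  A != [::] -> (forall i, I i = 0%N) -> chain_coef g A I = 0.
Proof.
case: A => // a A _ I0 /=; rewrite [X in _ + X]big1 ?addr0 => [|j]; last first.
  by rewrite I0.
elim: A a => [|b A IH] a /=.
  have -> : [forall i, I i == 0%N] by apply/forallP => i; rewrite I0.
  exact: (der1 (pserD_derivation _ _ _)).
rewrite IH add0r big1 ?(der0 (pserD_derivation _ _ _)) // => j.
by rewrite I0.
Qed.

End ChainCoef.

Section ChainRule.
Variables (K : fieldType) (n m p : nat).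
Variables (sigma : 'I_m -> {mpoly K[n]}) (jj : 'I_n -> 'I_m).
Hypothesis jac_neq0 : jac sigma jj != 0.
Local Notation Dop := (Dop sigma jj).
Variable phi : {rmorphism {mpoly K[n]} -> pser K p}.
Hypothesis phi_const : forall c, phi c%:MP = pserC p c.
Hypothesis phi_jac : phi (jac sigma jj) != 0.
Local Notation g := (fun i => phi (sigma (jj i))).
Local Notation incr I j := (fun i => if i == j then (I i).+1 else I i).
Local Notation decr I j := (fun i => if i == j then (I i).-1 else I i).

Lemma foldr_fracD_tofrac (A : seq 'I_p) (s : pser K p) :
  foldr (fun a : 'I_p => fracD (@pserD K p a)) s%:F A = (pserDA A s)%:F.
Proof.
by elim: A => //= a A ->; rewrite (fracD_tofrac (pserD_derivation K p a)).
Qed.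

(* The substitution I := I + e_j; it leaves the box of multiplicities bounded by
   [N] exactly when [I j = N], where [u] is assumed to vanish. *)
Lemma sum_shift (N : nat) (V : zmodType) (j : 'I_n)
    (u : ('I_n -> nat) -> ('I_n -> nat) -> V) :
  (forall I : 'I_n -> nat, I j = N -> u I (incr I j) = 0) ->
  \sum_(I : {ffun 'I_n -> 'I_N.+1} | (0 < I j)%N)
     u (decr (fun i => I i : nat) j) (fun i => I i) =
  \sum_(I : {ffun 'I_n -> 'I_N.+1}) u (fun i => I i) (incr (fun i => I i : nat) j).
Proof.
move=> uN.
rewrite [RHS](bigID (fun I : {ffun 'I_n -> 'I_N.+1} => (I j < N)%N)) /=.
rewrite [X in _ + X]big1 ?addr0; last first.
  move=> I; rewrite -leqNgt => jN; apply: uN.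
  by apply/eqP; rewrite eqn_leq jN -ltnS ltn_ord.
pose h (I : {ffun 'I_n -> 'I_N.+1}) : {ffun 'I_n -> 'I_N.+1} :=
  [ffun i => inord (if i == j then (I i).+1 else I i)].
pose h' (I : {ffun 'I_n -> 'I_N.+1}) : {ffun 'I_n -> 'I_N.+1} :=
  [ffun i => inord (if i == j then (I i).-1 else I i)].
have hE (I : {ffun 'I_n -> 'I_N.+1}) i : (I j < N)%N ->
    (h I i : nat) = if i == j then (I i).+1 else I i.
  move=> IN; rewrite ffunE inordK //.
  by case: eqP => [->|_].
have h'E (I : {ffun 'I_n -> 'I_N.+1}) i :
    (h' I i : nat) = if i == j then (I i).-1 else I i.
  rewrite ffunE inordK //.
  by case: eqP => [_|_] //; apply: leq_ltn_trans (leq_pred _) (ltn_ord _).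
rewrite (reindex_onto h h') /=; last first.
  move=> I Ij; apply/ffunP => i; apply: val_inj => /=.
  have Hj : (h' I j < N)%N.
    by rewrite h'E eqxx -ltnS prednK // ltn_ord.
  rewrite hE // !h'E; case: eqP => // ->.
  by rewrite prednK.
apply: eq_big => [I|I].
  apply/andP/idP => [[hj /eqP /ffunP /(_ j) /(congr1 val) /=]|IN].
    rewrite h'E eqxx => E; move: hj; rewrite -E ffunE eqxx.
    set x := (inord _ : 'I_N.+1) => x0; rewrite -ltnS prednK //.
  split; first by rewrite hE // eqxx.
  apply/eqP/ffunP => i; apply: val_inj; rewrite /= h'E hE //.
  by case: eqP.
move=> /andP [hj /eqP /ffunP E]; have IN : (I j < N)%N.
  have := congr1 val (E j); rewrite /= h'E eqxx => <-.
  by rewrite -ltnS prednK // ltn_ord.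
congr (u _ _); apply: funext => i /=.
  have := congr1 val (E i); rewrite /= h'E => <-.
  by [].
by rewrite hE.
Qed.

(** Induction along the recursion of [chain_coef]: a further derivative hits either the coefficient
    or the value, and in the second case raises one entry of [I]. The bound [N] is independent of
    [A], so the index set stays fixed during the induction. *)
Lemma chain_fval_multi (x : {fraction {mpoly K[n]}}) (N : nat) (A : seq 'I_p) :
  fval_def phi x -> (size A <= N)%N ->
  foldr (fun a : 'I_p => fracD (@pserD K p a)) (fval phi x) A =
  \sum_(I : {ffun 'I_n -> 'I_N.+1})
     (chain_coef g A (fun i => I i))%:F *
     fval phi (foldr Dop x (cnt_seq (fun i => I i))).
Proof.
move=> dx; elim: A => [|a A IH] /= sA.
  rewrite (bigD1 [ffun=> ord0]) //= [X in _ + X]big1 ?addr0; last first.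
    move=> I I0; case: forallP => [E|_]; last by rewrite tofrac0 mul0r.
    case/eqP: I0; apply/ffunP => i; apply: val_inj; rewrite ffunE /=.
    exact/eqP/E.
  case: forallP => [_|[]]; last by move=> i; rewrite ffunE.
  have -> : cnt_seq (fun i => ([ffun=> ord0] : {ffun 'I_n -> 'I_N.+1}) i) = [::].
    apply/nilP; rewrite /nilp size_cnt_seq big1 // => i _.
    by rewrite ffunE.
  by rewrite tofrac1 mul1r.
have derF := fracD_derivation (pserD_derivation K p a).
have pserD_phi c : @pserD K p a (phi c%:MP) = 0 by rewrite phi_const pserDC.
rewrite IH 1?ltnW // (der_sum derF).
under [RHS]eq_bigr => I _ do rewrite tofracD mulrDl raddf_sum mulr_suml.
rewrite big_split /=.
under eq_bigr => I _.
  rewrite derF.2 (fracD_tofrac (pserD_derivation K p a)).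
  rewrite (chain_fval_Dop jac_neq0 phi_jac (pserD_derivation K p a) pserD_phi);
    last exact: fval_foldr_Dop_def.
  under eq_bigr => j _ do rewrite (Dop_cnt_seq jac_neq0).
  rewrite mulr_sumr.
  over.
rewrite big_split /=; congr (_ + _).
rewrite exchange_big /= [RHS](exchange_big_dep xpredT) //=.
apply: eq_bigr => j _; apply/esym.
pose u (I I' : 'I_n -> nat) := (chain_coef g A I)%:F *
  ((pserD a (phi (sigma (jj j))))%:F * fval phi (foldr Dop x (cnt_seq I'))).
rewrite -[RHS](@sum_shift N _ j u).
  by apply: eq_bigr => I _; rewrite /u tofracM; ring.
(* At the edge of the box [I] has size at least [N], which exceeds the size of the shorter [A], so
   nothing is lost by the shift. *)
move=> I IN; rewrite /u chain_coef_gt ?tofrac0 ?mul0r //.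
by apply: (leq_trans sA); rewrite -IN (bigD1 j) //= leq_addr.
Qed.

End ChainRule.

(** * Polarization and the group action *)

Section LinearSubstitution.
Variables (K : fieldType) (n : nat).

Lemma lin_comp_is_zmod_morphism (g : 'M[K]_n) : zmod_morphism (lin_comp g).
Proof. exact: mmap_is_additive. Qed.

Lemma lin_comp_is_monoid_morphism (g : 'M[K]_n) : monoid_morphism (lin_comp g).
Proof.
pose h := mmap (@mpolyC n K) (fun i => \sum_(j < n) g i j *: 'X_j).
by split; [exact: (rmorph1 h)|exact: (rmorphM h)].
Qed.

HB.instance Definition _ (g : 'M[K]_n) :=
  GRing.isZmodMorphism.Build _ _ (lin_comp g) (lin_comp_is_zmod_morphism g).
HB.instance Definition _ (g : 'M[K]_n) :=
  GRing.isMonoidMorphism.Build _ _ (lin_comp g) (lin_comp_is_monoid_morphism g).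

Lemma lin_compC g c : lin_comp g c%:MP = c%:MP :> {mpoly K[n]}.
Proof. exact: mmapC. Qed.

Lemma lin_compX g i : lin_comp g 'X_i = \sum_(j < n) g i j *: 'X_j :> {mpoly K[n]}.
Proof. by rewrite /lin_comp mmapX mmap1U. Qed.

Lemma lin_comp_mul g h (P : {mpoly K[n]}) :
  lin_comp h (lin_comp g P) = lin_comp (g *m h) P.
Proof.
elim/mpoly_ring_ind: P => [c|i|p q IHp IHq|p q IHp IHq].
- by rewrite !lin_compC.
- rewrite !lin_compX rmorph_sum /=.
  under eq_bigr => j _.
    rewrite -mul_mpolyC rmorphM /= lin_compC lin_compX mulr_sumr.
    over.
  rewrite exchange_big; apply: eq_bigr => k _ /=.
  rewrite mxE scaler_suml; apply: eq_bigr => j _.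
  by rewrite mul_mpolyC scalerA.
- by rewrite !rmorphD /= IHp IHq.
- by rewrite !rmorphM /= IHp IHq.
Qed.

Lemma lin_comp1 P : lin_comp 1%:M P = P :> {mpoly K[n]}.
Proof.
elim/mpoly_ring_ind: P => [c|i|p q IHp IHq|p q IHp IHq].
- by rewrite lin_compC.
- rewrite lin_compX (bigD1 i) //= mxE eqxx scale1r big1 ?addr0 // => j ji.
  by rewrite mxE eq_sym (negbTE ji) scale0r.
- by rewrite rmorphD /= IHp IHq.
- by rewrite rmorphM /= IHp IHq.
Qed.

(** Substituting the inverse matrix undoes [lin_comp g]. *)
Lemma lin_comp_neq0 g (P : {mpoly K[n]}) :
  g \in unitmx -> P != 0 -> lin_comp g P != 0.
Proof.
move=> gU; apply: contra => /eqP gP.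
by rewrite -(lin_comp1 P) -(mulmxV gU) -lin_comp_mul gP rmorph0.
Qed.

Lemma mderiv_lin_comp g a (P : {mpoly K[n]}) :
  (lin_comp g P)^`M(a) = \sum_(b < n) g b a *: lin_comp g P^`M(b).
Proof.
rewrite (chain_mpoly (phi := lin_comp g) (mderiv_derivation K a)) => [|c]; last first.
  by rewrite /= lin_compC mderivC.
apply: eq_bigr => b _; rewrite /= lin_compX raddf_sum /= (bigD1 a) //= big1 ?addr0.
  by rewrite mderivZ mderivX1 eqxx -mul_mpolyC mulr1 mul_mpolyC.
by move=> j /negbTE ja; rewrite mderivZ mderivX1 ja scaler0.
Qed.

Lemma mcoeff0_lin_comp g (P : {mpoly K[n]}) : (lin_comp g P)@_0%MM = P@_0%MM.
Proof.
elim/mpoly_ring_ind: P => [c|i|p q IHp IHq|p q IHp IHq].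
- by rewrite lin_compC.
- rewrite lin_compX raddf_sum /= big1.
    by rewrite mcoeffX mnm1_eq0.
  by move=> j _; rewrite mcoeffZ mcoeffX mnm1_eq0 mulr0.
- by rewrite rmorphD /= !mcoeffD IHp IHq.
- by rewrite rmorphM /= !rmorphM /= IHp IHq.
Qed.

End LinearSubstitution.

Section Polarization.
Variables (K : fieldType) (n : nat).

Lemma sum_ffunS (V : nmodType) (T : finType) d (u : {ffun 'I_d.+1 -> T} -> V) :
  \sum_a u a =
  \sum_(x : T) \sum_(b : {ffun 'I_d -> T})
     u [ffun k => oapp b x (unlift ord0 k)].
Proof.
rewrite pair_big /=.
rewrite (reindex (fun xb : T * {ffun 'I_d -> T} =>
  [ffun k => oapp xb.2 xb.1 (unlift ord0 k)])) //=.
exists (fun a => (a ord0, [ffun k => a (lift ord0 k)])) => [[x b] _|a _] /=.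
  congr pair; first by rewrite ffunE unlift_none.
  by apply/ffunP => k; rewrite !ffunE liftK.
apply/ffunP => k; rewrite ffunE.
by case: unliftP => [j|] -> /=; rewrite ?ffunE.
Qed.

(* The functional [l] is arbitrary because the induction on [d] peels off the
   outermost derivative and absorbs it into [l]. *)
Lemma polar_sum_lin_comp (T : comNzRingType) (e : {rmorphism K -> T})
    (g : 'M[K]_n) (tau : {mpoly K[n]}) d (l : {mpoly K[n]} -> T)
    (w : 'I_d -> 'I_n -> T) :
  (forall P Q, l (P + Q) = l P + l Q) -> (forall c P, l (c *: P) = e c * l P) ->
  \sum_(a : {ffun 'I_d -> 'I_n})
     l (foldr (fun k P => P^`M(a k)) (lin_comp g tau) (enum 'I_d)) *
     \prod_(k < d) w k (a k) =
  \sum_(a : {ffun 'I_d -> 'I_n})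
     l (lin_comp g (foldr (fun k P => P^`M(a k)) tau (enum 'I_d))) *
     \prod_(k < d) \sum_(b < n) e (g (a k) b) * w k b.
Proof.
elim: d l w => [|d IH] l w lD lZ.
  apply: eq_bigr => a _; rewrite !big_ord0; congr (l _ * _).
  by rewrite (size0nil (size_enum_ord 0)).
have foldrS (P : {mpoly K[n]}) x (b : {ffun 'I_d -> 'I_n}) :
    foldr (fun k P => P^`M([ffun k => oapp b x (unlift ord0 k)] k)) P (enum 'I_d.+1) =
    (foldr (fun k P => P^`M(b k)) P (enum 'I_d))^`M(x).
  rewrite enum_ordSl /= ffunE unlift_none /=; congr (_^`M(x)).
  by elim: (enum 'I_d) => //= k s ->; rewrite ffunE liftK.
rewrite !sum_ffunS.
under eq_bigr => x _.
  under eq_bigr => b _.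
    rewrite foldrS big_ord_recl ffunE unlift_none /= mulrCA.
    under eq_bigr => k _ do rewrite ffunE liftK /=.
    over.
  rewrite -mulr_sumr (IH (fun P => l P^`M(x)) (fun k => w (lift ord0 k))); first last.
  - by move=> c P; rewrite mderivZ lZ.
  - by move=> P Q; rewrite mderivD lD.
  rewrite mulr_sumr.
  over.
under [RHS]eq_bigr => x _.
  under eq_bigr => b _.
    rewrite foldrS big_ord_recl ffunE unlift_none /=.
    under [X in _ * (_ * X)]eq_bigr => k _ do rewrite ffunE liftK /=.
    rewrite mulrCA mulr_suml.
    over.
  rewrite exchange_big /=.
  over.
rewrite /= [RHS]exchange_big /=; apply: eq_bigr => x _.
rewrite exchange_big /=; apply: eq_bigr => b _.
have l0 : l 0 = 0 by apply: (addrI (l 0)); rewrite -lD !addr0.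
rewrite mderiv_lin_comp (big_morph l lD l0) mulr_suml mulr_sumr.
by apply: eq_bigr => y _; rewrite lZ; ring.
Qed.

(** Equivariance of polarization: acting on the form amounts to acting on its arguments. The
    functional used is the constant coefficient, which a linear substitution fixes. *)
Lemma polar_lin_comp (T : comNzRingType) (e : {rmorphism K -> T})
    (g : 'M[K]_n) (tau : {mpoly K[n]}) d (w : 'I_d -> 'I_n -> T) :
  polar e (lin_comp g tau) w =
  polar e tau (fun k a => \sum_(b < n) e (g a b) * w k b).
Proof.
rewrite /polar; congr (_ * _).
rewrite (polar_sum_lin_comp (e := e) g tau (l := fun P => e P@_0%MM)); first last.
- by move=> c P; rewrite mcoeffZ rmorphM.
- by move=> P Q; rewrite mcoeffD rmorphD.
by apply: eq_bigr => a _; rewrite mcoeff0_lin_comp.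
Qed.

(** A product of sums becomes a sum over choice functions [f]; this produces the sum over families
    of indices in [tTfrak]. *)
Lemma polar_multilinear (T : comNzRingType) (e : K -> T) (tau : {mpoly K[n]}) d
    (J : finType) (Q : 'I_d -> pred J) (c : 'I_d -> J -> T)
    (w : 'I_d -> J -> 'I_n -> T) :
  polar e tau (fun k a => \sum_(j | Q k j) c k j * w k j a) =
  \sum_(f in family Q)
     (\prod_(k < d) c k (f k)) * polar e tau (fun k => w k (f k)).
Proof.
rewrite /polar; under [RHS]eq_bigr => f _ do rewrite mulrCA mulr_sumr.
rewrite -mulr_sumr; congr (_ * _); rewrite exchange_big; apply: eq_bigr => a _ /=.
rewrite bigA_distr_big_dep mulr_sumr; apply: eq_bigr => f _.
by rewrite big_split /= mulrCA.
Qed.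

Lemma polar_rmorph (T T' : comNzRingType) (h : {rmorphism T -> T'}) (e : K -> T)
    (tau : {mpoly K[n]}) d (w : 'I_d -> 'I_n -> T) :
  h (polar e tau w) = polar (h \o e) tau (fun k a => h (w k a)).
Proof.
rewrite /polar rmorphM rmorph_sum; congr (_ * _).
by apply: eq_bigr => a _; rewrite rmorphM rmorph_prod.
Qed.

Lemma polar_fval_rep (B : idomainType) (phi : {rmorphism {mpoly K[n]} -> B})
    (tau : {mpoly K[n]}) d (w : 'I_d -> 'I_n -> {fraction {mpoly K[n]}})
    (w' : 'I_d -> 'I_n -> {fraction B}) :
  (forall k a, fval_rep phi (w k a) (w' k a)) ->
  fval_rep phi (polar (fun c : K => (c%:MP)%:F) tau w)
               (polar (fun c : K => (phi c%:MP)%:F) tau w').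
Proof.
move=> ww'; apply: fvalM_rep; first exact: fval_tofrac_rep.
apply: fval_sum_rep => a _; apply: fvalM_rep; first exact: fval_tofrac_rep.
exact: fval_prod_rep.
Qed.

End Polarization.

(** * Pole orders and invariant numerators *)

Section Poles.
Variables (K : fieldType) (n m : nat).
Variables (sigma : 'I_m -> {mpoly K[n]}) (jj : 'I_n -> 'I_m).
Hypothesis jac_neq0 : jac sigma jj != 0.
Local Notation FV := {fraction {mpoly K[n]}}.
Local Notation J := (jac sigma jj).
Local Notation Dop := (Dop sigma jj).

(** Pole order at most [k] along the Jacobian and no pole elsewhere, measured by powers of [J] as a
    whole, without factoring it. *)
Definition pole_le (k : nat) (x : FV) : Prop :=
  exists P : {mpoly K[n]}, x * (J ^+ k)%:F = P%:F.

Lemma pole_le_weaken k l x : (k <= l)%N -> pole_le k x -> pole_le l x.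
Proof.
move=> kl [P xP]; exists (P * J ^+ (l - k)).
by rewrite -(subnKC kl) addKn exprD tofracM mulrA xP tofracM.
Qed.

Lemma pole_le_tofrac P : pole_le 0 P%:F.
Proof. by exists P; rewrite expr0 tofrac1 mulr1. Qed.

Lemma pole_leM k l x z : pole_le k x -> pole_le l z -> pole_le (k + l) (x * z).
Proof.
move=> [P xP] [Q zQ]; exists (P * Q).
by rewrite exprD !tofracM -xP -zQ; ring.
Qed.

Lemma pole_le_sum (I : Type) (r : seq I) (P : pred I) k (F : I -> FV) :
  (forall i, P i -> pole_le k (F i)) -> pole_le k (\sum_(i <- r | P i) F i).
Proof.
move=> H; apply: (big_ind (pole_le k)) => // [|x z [Q xQ] [S zS]].
  by exists 0; rewrite mul0r tofrac0.
by exists (Q + S); rewrite mulrDl xQ zS tofracD.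
Qed.

Lemma pole_le_prod (I : Type) (r : seq I) (k : I -> nat) (F : I -> FV) :
  (forall i, pole_le (k i) (F i)) ->
  pole_le (\sum_(i <- r) k i) (\prod_(i <- r) F i).
Proof.
move=> H; apply: (big_ind2 pole_le) => // [|? ? ? ?]; last exact: pole_leM.
exact: (pole_le_tofrac 1).
Qed.

Lemma pole_le_cmx a i : pole_le 1 (cmx sigma jj a i).
Proof.
by eexists; rewrite cmxE // expr1 mulfVK // tofrac_eq0.
Qed.

Lemma pole_le_fderiv a k x : pole_le k x -> pole_le k.+1 (fderiv a x).
Proof.
(* With [P] equal to [x] times the [k]-th power of [J], the Leibniz rule for [P], multiplied by [J],
   gives this numerator. *)
move=> [P xP]; exists (J * P^`M(a) - (J^`M(a) * P) *+ k).
have D2 := (fderiv_derivation K a).2 x (J ^+ k)%:F.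
rewrite xP !fderiv_tofrac in D2.
rewrite tofracB tofracM D2 tofracMn tofracM -xP exprS tofracM.
case: k {xP D2} => [|k]; first by rewrite expr0 mderivC tofrac0 mulr0n; ring.
rewrite (derXn (mderiv_derivation K a)) tofracMn exprS !tofracM -mulr_natr.
by rewrite -[in RHS]mulr_natr; ring.
Qed.

(** One order comes from the inverse Jacobian matrix and one from differentiating. On a polynomial
    the second is absent, which saves one order for each nonempty index. *)
Lemma pole_le_Dop i k x : pole_le k x -> pole_le k.+2 (Dop i x).
Proof.
move=> kx; apply: pole_le_sum => a _; rewrite -add1n.
by apply: pole_leM; [exact: pole_le_cmx|exact: pole_le_fderiv].
Qed.

Lemma pole_le_Dop_tofrac i P : pole_le 1 (Dop i P%:F).
Proof.
apply: pole_le_sum => a _; rewrite -[1%N]addn0; apply: pole_leM.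
  exact: pole_le_cmx.
by rewrite fderiv_tofrac; exact: pole_le_tofrac.
Qed.

(* [.-1] is truncated: for [s] empty the order is [0]. *)
Lemma pole_le_dIv s a : pole_le (2 * size s).-1 (dIv sigma jj s a).
Proof.
case: s => [|i s]; first exact: pole_le_tofrac.
elim: s i => [|j s IH] i; first exact: pole_le_Dop_tofrac.
have -> : (2 * size [:: i, j & s]).-1 = (2 * size (j :: s)).-1.+2 by rewrite /=; lia.
exact: pole_le_Dop (IH j).
Qed.

Lemma pole_le_polar tau d (k : 'I_d -> nat) (w : 'I_d -> 'I_n -> FV) :
  (forall i a, pole_le (k i) (w i a)) ->
  pole_le (\sum_i k i) (polar (fun c : K => (c%:MP)%:F) tau w).
Proof.
move=> kw; rewrite -[(\sum_i k i)%N]add0n; apply: pole_leM.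
  exact: pole_le_tofrac.
apply: pole_le_sum => a _; rewrite -[(\sum_i k i)%N]add0n; apply: pole_leM.
  exact: pole_le_tofrac.
exact: pole_le_prod.
Qed.

Section Action.
Variable g : 'M[K]_n.
Hypothesis gU : g \in unitmx.
Hypothesis g_coord : forall i, lin_comp g (sigma (jj i)) = sigma (jj i).

Lemma fval_lin_comp_def x : fval_def (lin_comp g) x.
Proof.
have [P [Q [Q0 ->]]] := fracP x.
by eexists; apply: fval_frac_rep; exact: lin_comp_neq0.
Qed.

(** Since [g] fixes the coordinates, the chain rule through [lin_comp g] has the coefficients of the
    original Jacobian matrix, and contracting with its inverse isolates the [j]-th term. *)
Lemma Dop_lin_comp j x :
  Dop j (fval (lin_comp g) x) = fval (lin_comp g) (Dop j x).
Proof.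
have chain b : fderiv b (fval (lin_comp g) x) =
    \sum_i ((sigma (jj i))^`M(b))%:F * fval (lin_comp g) (Dop i x).
  rewrite fderivE (chain_fval_Dop jac_neq0 _ (mderiv_derivation K b) _
    (fval_lin_comp_def x)).
  - by apply: eq_bigr => i _; rewrite /= g_coord.
  - exact: lin_comp_neq0.
  - by move=> c; rewrite /= lin_compC mderivC.
rewrite /Defs.Dop; under eq_bigr => b _ do rewrite chain mulr_sumr.
(* After the exchange the coefficient of the [i]-th term is [Dop j] of the [i]-th coordinate, a
   Kronecker delta. *)
rewrite exchange_big (bigD1 j) //= [X in _ + X]big1 ?addr0 => [|i ij].
  under eq_bigr => b _ do rewrite mulrA -fderiv_tofrac.
  by rewrite -mulr_suml -/(Defs.Dop sigma jj j _) Dop_coord // eqxx mul1r.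
under eq_bigr => b _ do rewrite mulrA -fderiv_tofrac.
by rewrite -mulr_suml -/(Defs.Dop sigma jj j _) Dop_coord // (negbTE ij) mul0r.
Qed.

Lemma dIv_lin_comp s a :
  fval (lin_comp g) (dIv sigma jj s a) =
  \sum_b ((g a b)%:MP)%:F * dIv sigma jj s b.
Proof.
elim: s => [|i s IH].
  rewrite (fvalE (fval_tofrac_rep _ _)) /= lin_compX raddf_sum.
  by apply: eq_bigr => b _; rewrite -tofracM mul_mpolyC.
rewrite -[LHS]/(fval _ (Dop i (dIv sigma jj s a))) -Dop_lin_comp IH.
rewrite (der_sum (Dop_derivation _ _ _)); apply: eq_bigr => b _.
by rewrite (Dop_derivation _ _ _).2 Dop_const mul0r add0r.
Qed.

(** By [dIv_lin_comp] the group element acts on every argument through the matrix [g]; equivariance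
    moves this action onto [tau], which is fixed. *)
Lemma polar_dIv_lin_comp tau d (I : 'I_d -> seq 'I_n) :
  lin_comp g tau = tau ->
  let T := polar (fun c : K => (c%:MP)%:F) tau (fun k => dIv sigma jj (I k)) in
  fval (lin_comp g) T = T.
Proof.
move=> gtau T.
pose e : {rmorphism K -> FV} := @FracField.tofrac {mpoly K[n]} \o @mpolyC n K.
transitivity (polar e (lin_comp g tau) (fun k => dIv sigma jj (I k))).
  2: by rewrite gtau.
rewrite polar_lin_comp; apply: fvalE.
have H k a : fval_rep (lin_comp g) (dIv sigma jj (I k) a)
    (\sum_b e (g a b) * dIv sigma jj (I k) b).
  by rewrite -dIv_lin_comp; exact: fvalP (fval_lin_comp_def _).
have := polar_fval_rep tau H.
suff -> : (fun c : K => (lin_comp g c%:MP)%:F) = e by [].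
by apply: funext => c; rewrite lin_compC.
Qed.

End Action.

(** The pole bound makes the product a polynomial. It is invariant because both factors are fixed by
    the extension of [lin_comp g] to fractions, and polynomials embed in fractions. *)
Lemma polar_dIv_numer (G : seq 'M[K]_n) tau d (I : 'I_d -> seq 'I_n) D M Q :
  (forall g, g \in G -> g \in unitmx) ->
  (forall i, Ginvariant G (sigma (jj i))) -> Ginvariant G tau ->
  Ginvariant G D -> D = J ^+ M * Q -> (\sum_k (2 * size (I k)).-1 <= M)%N ->
  exists P, Ginvariant G P /\
   polar (fun c : K => (c%:MP)%:F) tau (fun k => dIv sigma jj (I k)) * D%:F = P%:F.
Proof.
move=> GU Gs Gtau GD DJ sM; set T := polar _ _ _.
have [P TP] : pole_le M T.
  by apply: pole_le_weaken sM _; apply: pole_le_polar => k a; exact: pole_le_dIv.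
exists (P * Q); have E : T * D%:F = (P * Q)%:F.
  by rewrite DJ tofracM mulrA TP tofracM.
split=> // g gG; apply/eqP; rewrite -tofrac_eq -E; apply/eqP.
have := fvalE (fval_tofrac_rep (lin_comp g) (P * Q)) => /= <-; rewrite -E.
apply: fvalE; apply: fvalM_rep; last first.
  by rewrite -{2}(GD g gG); exact: fval_tofrac_rep.
have gT := polar_dIv_lin_comp (GU _ gG) (fun i => Gs i g gG) I (Gtau g gG).
by have := fvalP (fval_lin_comp_def (GU _ gG) T); rewrite gT.
Qed.

End Poles.

(** * Evaluating invariant rational functions *)

Section Invariants.
Variables (K : fieldType) (n p : nat) (G : seq 'M[K]_n).

Lemma GinvariantX P k : Ginvariant G P -> Ginvariant G (P ^+ k).
Proof. by move=> GP g gG; rewrite rmorphXn /= GP. Qed.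

Variable f : {mpoly K[n]} -> pser K p.
Hypothesis fG : formal_morZ G f.

Lemma formal_morZX P k : Ginvariant G P -> f (P ^+ k) = f P ^+ k.
Proof.
case: fG => _ fM fC GP; elim: k => [|k IH].
  by rewrite !expr0 -[1 in LHS]mpolyC1 fC rmorph1.
by rewrite !exprS fM ?IH //; exact: GinvariantX.
Qed.

Lemma formal_morZ0 : f 0 = 0.
Proof. by case: fG => _ _ fC; rewrite -mpolyC0 fC rmorph0. Qed.

Lemma fapp_rep_uniq psi q q' : fapp_rep G f psi q -> fapp_rep G f psi q' -> q = q'.
Proof.
case: fG => _ fM _ [P [Q [GP GQ Q0 -> ->]]] [P' [Q' [GP' GQ' Q'0 E ->]]].
have N0 R : f R != 0 -> R != 0.
  by apply: contra => /eqP ->; rewrite formal_morZ0.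
apply/eqP; move/eqP: E; rewrite !eq_frac ?N0 // => /eqP E.
by rewrite -!fM // E.
Qed.

Lemma fappE psi q : fapp_rep G f psi q -> fapp G f psi = q.
Proof.
move=> H; rewrite /fapp; case: pselect => [h|[]]; last by exists q.
exact: fapp_rep_uniq (projT2 (cid h)) H.
Qed.

End Invariants.

(** * Formal morphisms *)

Section FormalMorphisms.
Variables (K : fieldType) (n p : nat) (F : 'I_n -> pser K p).

Lemma formal_morV_is_zmod_morphism : zmod_morphism (formal_morV F).
Proof. exact: mmap_is_additive. Qed.

Lemma formal_morV_is_monoid_morphism : monoid_morphism (formal_morV F).
Proof.
pose h := mmap (@pserC K p) F.
by split; [exact: (rmorph1 h)|exact: (rmorphM h)].
Qed.

HB.instance Definition _ :=
  GRing.isZmodMorphism.Build _ _ (formal_morV F) formal_morV_is_zmod_morphism.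
HB.instance Definition _ :=
  GRing.isMonoidMorphism.Build _ _ (formal_morV F) formal_morV_is_monoid_morphism.

Lemma formal_morVC c : formal_morV F c%:MP = pserC p c.
Proof. exact: mmapC. Qed.

Lemma formal_morVX i : formal_morV F 'X_i = F i.
Proof. by rewrite /formal_morV mmapX mmap1U. Qed.

Lemma formal_morV_formal_morZ (G : seq 'M[K]_n) : formal_morZ G (formal_morV F).
Proof.
by split=> [P Q _ _|P Q _ _|c]; rewrite ?rmorphD ?rmorphM ?formal_morVC.
Qed.

End FormalMorphisms.

(** * The transformed form: compatibility with lifts and integrality *)

Section TransformedForm.
Variables (K : fieldType) (n m p : nat) (G : seq 'M[K]_n).
Variables (sigma : 'I_m -> {mpoly K[n]}) (jj : 'I_n -> 'I_m).
Variables (D1 DM Q1 QM tau : {mpoly K[n]}) (d d' : nat) (A : 'I_d -> seq 'I_p).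
Local Notation M := (2 * (\sum_(k < d) size (A k)) - d')%N.
Local Notation N := (\sum_(k < d) size (A k))%N.
Local Notation J := (jac sigma jj).
Local Notation multi := {ffun 'I_n -> 'I_N.+1}.
Local Notation T I := (polar (fun c : K => (c%:MP)%:F) tau
  (fun k => dIv sigma jj (cnt_seq (fun i => (I : {ffun 'I_d -> multi}) k i)))).
Hypothesis GU : forall g, g \in G -> g \in unitmx.
Hypothesis Gsigma : forall j, Ginvariant G (sigma j).
Hypothesis jac_neq0 : J != 0.
Hypothesis Gtau : Ginvariant G tau.
Hypothesis d'_le : (d' <= d)%N.
Hypothesis A_nil : forall k : 'I_d, (A k != [::]) = (k < d')%N.
Hypothesis GD1 : Ginvariant G D1.
Hypothesis D1E : D1 = J ^+ 1 * Q1.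
Hypothesis GDM : Ginvariant G DM.
Hypothesis DME : DM = J ^+ M * QM.

Definition admissible (k : 'I_d) : pred multi := fun I =>
  if (k < d')%N then (1 <= \sum_(i < n) (I i : nat) <= size (A k))%N
  else [forall i, (I i : nat) == 0%N].

Lemma sum_pole_orders (I : {ffun 'I_d -> multi}) :
  (forall k, admissible k (I k)) ->
  (\sum_k (2 * size (cnt_seq (fun i => I k i))).-1 <= M)%N.
Proof.
move=> adm.
have le k : ((2 * size (cnt_seq (fun i => I k i))).-1 <= (2 * size (A k)).-1)%N.
  rewrite size_cnt_seq; have := adm k; rewrite /admissible.
  case: ifP => _ => [/andP [_ H]|/forallP H].
    by rewrite -!subn1 leq_sub2r // leq_mul2l.
  by rewrite big1 // => i _; exact/eqP/H.
apply: (@leq_trans (\sum_k (2 * size (A k)).-1)%N); first exact: leq_sum.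
have sum1 : (\sum_(k < d) (k < d' : nat) = d')%N.
  transitivity (\sum_(k < d | k < d') 1)%N.
    by rewrite [RHS]big_mkcond; apply: eq_bigr => k _; case: (k < d')%N.
  by rewrite -(big_ord_widen d (fun=> 1%N) d'_le) sum1_card card_ord.
(* The truncated predecessor subtracts 1 exactly when [A k] is nonempty, that is [d'] times in all;
   this is the origin of the value of [M]. *)
have E : (\sum_k (2 * size (A k)).-1 + \sum_(k < d) (k < d' : nat) =
          2 * \sum_(k < d) size (A k))%N.
  rewrite -big_split big_distrr /=; apply: eq_bigr => k _.
  by rewrite -A_nil; case: (A k) => //= a s; lia.
by rewrite -E sum1 addnK.
Qed.

Section AtMorphism.
Variable f : {mpoly K[n]} -> pser K p.
Hypothesis fG : formal_morZ G f.
Hypothesis fD1 : f D1 != 0.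

(** The denominator is a power of [D1]: it is invariant, divisible by the [M]-th power of the
    Jacobian, and not killed by [f] since [f D1] is nonzero. *)
Lemma fapp_rep_polar (I : {ffun 'I_d -> multi}) :
  (forall k, admissible k (I k)) -> exists q, fapp_rep G f (T I) q.
Proof.
move=> /sum_pole_orders sM.
have [|P [GP TP]] := polar_dIv_numer jac_neq0 GU (fun i => Gsigma (jj i)) Gtau
    (D := D1 ^+ M) (GinvariantX M GD1) _ sM (Q := Q1 ^+ M).
  by rewrite D1E expr1 exprMn.
have f0 : f (D1 ^+ M) != 0 by rewrite (formal_morZX fG) // expf_neq0.
exists ((f P)%:F / (f (D1 ^+ M))%:F); exists P, (D1 ^+ M); split=> //.
  exact: GinvariantX.
rewrite -TP mulfK // tofrac_eq0 expf_neq0 //.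
by apply: contra fD1 => /eqP ->; rewrite (formal_morZ0 fG).
Qed.

(** Writing the form as [P / Q] and its product with [DM] as [R] gives [DM * P = R * Q] among
    invariants, where [f] is multiplicative; dividing by [f Q] leaves [f R]. *)
Lemma fapp_polar_integral (I : {ffun 'I_d -> multi}) :
  (forall k, admissible k (I k)) -> exists h, (f DM)%:F * fapp G f (T I) = h%:F.
Proof.
move=> adm; have [_ [P [Q [GP GQ Q0 TE _]]]] := fapp_rep_polar adm.
have [R [GR TR]] := polar_dIv_numer jac_neq0 GU (fun i => Gsigma (jj i)) Gtau
    GDM DME (sum_pole_orders adm).
have [_ fM _] := fG; exists (f R).
rewrite (@fappE _ _ _ _ _ fG _ ((f P)%:F / (f Q)%:F)); last by exists P, Q.
have QF0 : (f Q)%:F != 0 :> {fraction pser K p} by rewrite tofrac_eq0.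
have Qn0 : Q%:F != 0 :> {fraction {mpoly K[n]}}.
  by rewrite tofrac_eq0; apply: contra Q0 => /eqP ->; rewrite (formal_morZ0 fG).
apply: (mulIf QF0); rewrite mulrA mulfVK // -!tofracM -!fM //.
congr (f _)%:F; apply/eqP; rewrite -tofrac_eq !tofracM -TR TE; apply/eqP.
by rewrite mulrAC mulfVK // mulrC.
Qed.

Lemma tTfrak_integral : exists h, (f DM)%:F * tTfrak G sigma jj tau d' A f = h%:F.
Proof.
rewrite /tTfrak mulr_sumr.
apply: (big_ind (fun q => exists h : pser K p, q = h%:F)).
- by exists 0; rewrite tofrac0.
- by move=> _ _ [h ->] [k ->]; exists (h + k); rewrite tofracD.
move=> I /forallP adm; have [h hE] := fapp_polar_integral adm.
by rewrite mulrCA hE; eexists; rewrite -tofracM.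
Qed.

End AtMorphism.

Variable F : 'I_n -> pser K p.
Hypothesis FD1 : formal_morV F D1 != 0.
Local Notation phi := (formal_morV F).
Local Notation g := (fun i => phi (sigma (jj i))).

Lemma formal_morV_jac : phi J != 0.
Proof.
by apply: contra FD1 => /eqP J0; rewrite D1E expr1 rmorphM /= J0 mul0r.
Qed.

Lemma dIv_def s a : fval_def phi (dIv sigma jj s a).
Proof.
apply: (fval_foldr_Dop_def jac_neq0 formal_morV_jac).
by eexists; exact: fval_tofrac_rep.
Qed.

Lemma fapp_polar (I : {ffun 'I_d -> multi}) : (forall k, admissible k (I k)) ->
  fapp G phi (T I) =
  polar (@FracField.tofrac _ \o @pserC K p) tau
    (fun k a => fval phi (dIv sigma jj (cnt_seq (fun i => I k i)) a)).
Proof.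
move=> adm; have fG := formal_morV_formal_morZ F G.
have [q qT] := fapp_rep_polar fG FD1 adm; rewrite (fappE fG qT).
have qT' : fval_rep phi (T I) q.
  by case: qT => P [Q [_ _ Q0 TE qE]]; exists P, Q.
apply: fval_rep_uniq qT' _.
have H k a := fvalP (dIv_def (cnt_seq (fun i => I k i)) a).
have := polar_fval_rep tau H.
suff -> : (fun c : K => (phi c%:MP)%:F) = @FracField.tofrac _ \o @pserC K p by [].
by apply: funext => c; rewrite formal_morVC.
Qed.

Lemma pserDA_admissible k a :
  (pserDA (A k) (F a))%:F =
  \sum_(I | admissible k I)
     (if (k < d')%N then (chain_coef g (A k) (fun i => (I : multi) i))%:F else 1) *
     fval phi (dIv sigma jj (cnt_seq (fun i => I i)) a).
Proof.
have dX : fval_def phi ('X_a)%:F by eexists; exact: fval_tofrac_rep.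
have sA : (size (A k) <= N)%N by rewrite (bigD1 k) //= leq_addr.
rewrite -foldr_fracD_tofrac -formal_morVX -(fvalE (fval_tofrac_rep phi _)).
rewrite (chain_fval_multi jac_neq0 (formal_morVC F) formal_morV_jac dX sA).
rewrite [RHS]big_mkcond /=; apply: eq_bigr => I _.
rewrite -[foldr _ _ _]/(dIv sigma jj (cnt_seq (fun i => I i)) a) /admissible.
(* For nonempty [A k] the terms outside the admissible range have zero coefficient; for empty [A k]
   the coefficient is 1 at the zero index and 0 elsewhere. *)
have := A_nil k; case: ltnP => _ Ak.
  case: ifP => // /negbT; rewrite negb_and -leqNgt leqn0 -ltnNge => /orP [/eqP I0|I1].
    rewrite chain_coef_0 ?Ak ?tofrac0 ?mul0r // => i.
    by move/eqP: I0; rewrite sum_nat_eq0 => /forallP /(_ i) /eqP.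
  by rewrite chain_coef_gt // tofrac0 mul0r.
move/negbFE/eqP: Ak => -> /=.
by case: ifP => _; rewrite ?tofrac1 ?tofrac0 ?mul0r.
Qed.

Lemma tTfrak_formal_morV : tTfrak G sigma jj tau d' A phi = (Tfrak tau A F)%:F.
Proof.
rewrite /Tfrak (polar_rmorph (@FracField.tofrac (pser K p))).
have -> : (fun k a => (pserDA (A k) (F a))%:F) = (fun k a =>
  \sum_(I | admissible k I)
     (if (k < d')%N then (chain_coef g (A k) (fun i => (I : multi) i))%:F else 1) *
     fval phi (dIv sigma jj (cnt_seq (fun i => I i)) a)).
  by apply: funext => k; apply: funext => a; exact: pserDA_admissible.
rewrite polar_multilinear /tTfrak; apply: eq_big => [I|I /forallP adm].
  exact/forallP/familyP.
by rewrite fapp_polar // rmorph_prod big_mkcond.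
Qed.

End TransformedForm.

Theorem theorem3p5
  (R : realType)                          (* C = R[i] *)
  (n : nat) (G : seq 'M[R[i]]_n)
  (m : nat) (sigma : 'I_m -> {mpoly R[i][n]})
  (jj : 'I_n -> 'I_m)
  (D1 DM : {mpoly R[i][n]})
  (tau : {mpoly R[i][n]}) (d d' : nat) (p : nat) (A : 'I_d -> seq 'I_p) :
  finite_linear_group G ->
  min_hom_generators G sigma ->
  jac sigma jj != 0 ->
  Ginvariant G tau -> tau \is d.-homog ->
  (d' <= d)%N ->
  (forall k : 'I_d, (A k != [::]) = (k < d')%N) ->
  is_Delta G (jac sigma jj) 1 D1 ->
  is_Delta G (jac sigma jj) (2 * (\sum_(k < d) size (A k)) - d')%N DM ->
  (* (1) *)
  (forall F : 'I_n -> pser R[i] p,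
     formal_morV F D1 != 0 ->
     tTfrak G sigma jj tau d' A (formal_morV F) = (Tfrak tau A F)%:F)
  /\
  (* (2) *)
  (forall f : {mpoly R[i][n]} -> pser R[i] p,
     formal_morZ G f -> f D1 != 0 ->
     exists h : pser R[i] p, (f DM)%:F * tTfrak G sigma jj tau d' A f = h%:F).
Proof.
move=> [_ _ GU] [_ Gsigma _ _] jac_neq0 Gtau _ d'_le A_nil
  [GD1 [Q1 D1E] _ _] [GDM [QM DME] _ _].
split=> [F FD1|f fG fD1].
  exact: (tTfrak_formal_morV GU Gsigma jac_neq0 Gtau d'_le A_nil GD1 D1E).
exact: (tTfrak_integral GU Gsigma jac_neq0 Gtau d'_le A_nil GD1 D1E GDM DME).
Qed.
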